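(* Let $\mu$ be a Nevanlinna measure on $\mathbb{R}^n$. Then there exists a constant $M\ge0$ such that for any $\tau\in\mathbb{R}^n$ and $y>0$, $$\mu(D(\tau,y))\le\frac{M}{(2\pi)^n}\,\frac{y^{n-1}}{\sqrt n}\,\big(1+\|\tau\|_2^2+n y^2\big),$$ where $D(\tau,y):=\{t\in\mathbb{R}^n : |\tau_j-t_j|<y \text{ for all } j=1,\ldots,n\}$.
   Context: A positive Borel measure $\mu$ on $\mathbb{R}^n$ is called a Nevanlinna measure if it satisfies the growth condition $\int_{\mathbb{R}^n}\prod_{\ell=1}^n\frac{1}{1+t_\ell^2}\,d\mu(t)<\infty$ and the Nevanlinna condition $$\int_{\mathbb{R}^n}\frac{1}{(t_{j_1}-z_{j_1})^2(t_{j_2}-\overline{z_{j_2}})^2}\prod_{\ell\ne j_1,j_2}\Big(\frac{1}{t_\ell-z_\ell}-\frac{1}{t_\ell-\overline{z_\ell}}\Big)d\mu(t)=0$$ for all $z\in(\mathbb{C}^+)^n$ and all indices $1\le j_1<j_2\le n$, where $\mathbb{C}^+=\{z\in\mathbb{C}:\operatorname{Im} z>0\}$. $\|\cdot\|_2$ is the Euclidean norm. *)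

(* Defs.v *)
From HB Require Import structures.
From mathcomp Require Import all_boot all_order all_algebra.
From mathcomp Require Import complex.
From mathcomp Require Import all_classical all_reals all_analysis.

Set Implicit Arguments.
Unset Strict Implicit.
Unset Printing Implicit Defensive.
Import Order.TTheory GRing.Theory Num.Theory.
Import numFieldNormedType.Exports.

Local Open Scope classical_set_scope.
Local Open Scope ring_scope.
Local Open Scope complex_scope.

(* The literal Borel sigma-algebra, generated by the open sets. *)
Notation borelRn R n := (g_sigma_algebraType (@open 'rV[R]_n)).

(* [Rintegral] is total, so this is meaningful only when the real and imaginary
   parts of [f] are integrable. *)
Definition cintegral d (T : measurableType d) (R : realType)
    (mu : {measure set T -> \bar R}) (D : set T) (f : T -> R[i]) : R[i] :=
  (\int[mu]_(t in D) complex.Re (f t)) +i* (\int[mu]_(t in D) complex.Im (f t)).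

Definition growth_condition (R : realType) (n : nat)
    (mu : {measure set borelRn R n -> \bar R}) : Prop :=
  (\int[mu]_t (\prod_(l < n) (1 / (1 + (t : 'rV[R]_n) 0 l ^+ 2)))%:E < +oo)%E.

(* Under [growth_condition] the integrand is bounded in modulus by a constant
   multiple of [\prod_l (1 + t_l^2)^-1], so [cintegral] is a genuine absolutely
   convergent integral here. *)
Definition nevanlinna_condition (R : realType) (n : nat)
    (mu : {measure set borelRn R n -> \bar R}) : Prop :=
  forall z : 'rV[R[i]]_n, (forall l, 0 < complex.Im (z 0 l)) ->
  forall j1 j2 : 'I_n, (j1 < j2)%N ->
  cintegral mu setT (fun t : 'rV[R]_n =>
    1 / (((t 0 j1)%:C - z 0 j1) ^+ 2 * ((t 0 j2)%:C - (z 0 j2)^*) ^+ 2) *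
    \prod_(l < n | (l != j1) && (l != j2))
      (1 / ((t 0 l)%:C - z 0 l) - 1 / ((t 0 l)%:C - (z 0 l)^*))) = 0.

Definition nevanlinna_measure (R : realType) (n : nat)
    (mu : {measure set borelRn R n -> \bar R}) : Prop :=
  growth_condition mu /\ nevanlinna_condition mu.

(* The library norm on ['rV[R]_n] is the sup norm. *)
Definition norm2 (R : realType) (n : nat) (x : 'rV[R]_n) : R :=
  Num.sqrt (\sum_(j < n) x 0 j ^+ 2).

Definition open_cube (R : realType) (n : nat) (tau : 'rV[R]_n) (y : R) :
    set (borelRn R n) :=
  [set t : 'rV[R]_n | forall j : 'I_n, `|tau 0 j - t 0 j| < y].

(* Main.v *)
Require Import Defs.
From HB Require Import structures.
From mathcomp Require Import all_boot all_order all_algebra.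
From mathcomp Require Import complex.
From mathcomp Require Import all_classical all_reals all_analysis.
From mathcomp Require Import measurable_realfun ring lra.
Import Order.TTheory GRing.Theory Num.Theory.
Import numFieldNormedType.Exports.
Local Open Scope classical_set_scope.
Local Open Scope ring_scope.

Set Implicit Arguments.
Unset Strict Implicit.
Unset Printing Implicit Defensive.

(**
Write [p s y = y / (s^2 + y^2)] for the (unnormalized) Poisson kernel of the
upper half-plane, fix [tau], and let
  [v (x, y) = \int \prod_j p (t_j - tau_j - x) y dmu(t)],
which is the product Poisson integral of [mu] at the point whose coordinates
are [tau_j + x + i y]: all coordinates move together along one complex line.
On the cube [D(tau, y)] every factor [p (t_j - tau_j) y] is at least
[1 / (2 y)], whence [mu (D(tau, y)) <= (2 y)^n v (0, y)].  The growth condition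
alone bounds [v (0, y)] by a product of [n] factors; the point is that the
Nevanlinna condition makes [v] behave as in one variable.

Indeed, a single factor [p] is harmonic, so the Laplacian in [(x, y)] of the
product kernel only retains the mixed terms [d_j p * dbar_l p], [j != l], whose
integrals are, up to the factors [2 i], the integrals of the Nevanlinna
condition with all the [z_l - tau_l] equal.  Hence [v] is a positive harmonic
function on the upper half-plane (lemma [poissonint_harmonic]).

For a positive harmonic function, comparison with explicit harmonic barriers on
a rectangle, through the minimum principle, controls vertical rays up to
constants: [y v (0, y)] is almost nondecreasing (lemma [poissonint_climb]) and
[v (0, Y) / Y] is almost nonincreasing (lemma [poissonint_descend]).  The
barriers only see [v] near a single point [(0, y)] of the boundary of the
rectangle, where [v] is comparable to [v (0, y)] by comparing kernels.

With [Y^2 = 1 + |tau|^2 + n y^2], one climbs from height [y] to height [Y],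
which costs [Y / y]; at height [Y >= |tau_j|] the kernels centred at [tau] and
at [0] are comparable; then one descends from [Y] to [1], which costs [Y].
Altogether [v (0, y) <= C Y^2 / y], and this is the claim.

Harmonicity is only ever used through the five-point difference
[f (x+h, y) + f (x-h, y) + f (x, y+h) + f (x, y-h) - 4 f (x, y)] being
[O (h^3)] which, with continuity, is all that the minimum principle needs.  It
follows for [v] from third order expansions of the kernel whose remainders are
uniform in [t] relative to the kernel itself, so that no derivative is ever
taken under the integral sign.
*)

(** * Third order expansions of the Poisson kernel *)

Section Poisson.
Context {R : realType}.
Implicit Types s y h a b : R.

Definition poisson s y : R := y / (s ^+ 2 + y ^+ 2).

Lemma sqr_sum_gt0 s y : 0 < y -> 0 < s ^+ 2 + y ^+ 2.
Proof. by move=> y0; rewrite ltr_wpDl ?sqr_ge0// exprn_gt0. Qed.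

Lemma poisson_gt0 s y : 0 < y -> 0 < poisson s y.
Proof. by move=> y0; rewrite divr_gt0// sqr_sum_gt0. Qed.

Lemma poisson0 y : 0 < y -> poisson 0 y = y^-1.
Proof.
by move=> y0; rewrite /poisson expr0n add0r expr2 invfM mulrA divff ?mul1r// gt_eqF.
Qed.

Lemma poisson_le c s y s' y' : 0 < y -> 0 < y' ->
  y * (s' ^+ 2 + y' ^+ 2) <= c * y' * (s ^+ 2 + y ^+ 2) ->
  poisson s y <= c * poisson s' y'.
Proof.
move=> y0 y'0 H; rewrite /poisson ler_pdivrMr ?sqr_sum_gt0//.
by rewrite mulrA mulrAC ler_pdivlMr ?sqr_sum_gt0.
Qed.

(** The logarithmic derivatives of [poisson (s - x) y] in [x] and in [y]. *)
Definition dlogx s y : R := 2 * s / (s ^+ 2 + y ^+ 2).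
Definition dlogy s y : R := y^-1 - 2 * y / (s ^+ 2 + y ^+ 2).

(** These three lemmas turn the syntax of an expression into a bound for it, which
is how the constants below are produced. *)
Lemma normM_le (x x' u u' : R) : `|x| <= u -> `|x'| <= u' -> `|x * x'| <= u * u'.
Proof. by move=> ? ?; rewrite normrM ler_pM. Qed.

Lemma normD_le (x x' u u' : R) : `|x| <= u -> `|x'| <= u' -> `|x + x'| <= u + u'.
Proof. by move=> ? ?; rewrite (le_trans (ler_normD _ _))// lerD. Qed.

Lemma normB_le (x x' u u' : R) : `|x| <= u -> `|x'| <= u' -> `|x - x'| <= u + u'.
Proof. by move=> ? ?; apply: normD_le; rewrite ?normrN. Qed.

(** The error constant depends on a bound for the coefficients only, which is what
makes the expansions below uniform in the integration variable. *)
Lemma ratio_expansion (K : R) : 0 <= K -> exists2 C : R, 0 <= C &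
  forall n d e h : R, `|n| <= K -> `|d| <= K -> `|e| <= K ->
    0 <= h -> h <= 1 -> 4 * K * h <= 1 ->
  exists2 r : R, `|r| <= C &
    (1 + n * h) / (1 + d * h + e * h ^+ 2) =
      1 + (n - d) * h + (d ^+ 2 - e - n * d) * h ^+ 2 + r * h ^+ 3.
Proof.
move=> K0; evar (C : (R : Type)); exists `|C| => //.
move=> n d e h nK dK eK h0 h1 Kh.
have hh : `|h| <= 1 by rewrite ger0_norm.
have den : 2^-1 <= 1 + d * h + e * h ^+ 2.
  have : `|d * h| <= K * h by rewrite normrM (ger0_norm h0) ler_wpM2r.
  have : `|e * h ^+ 2| <= K * h.
    rewrite normrM (ger0_norm (sqr_ge0 h)) ler_pM ?sqr_ge0//.
    by rewrite expr2 ler_piMr.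
  rewrite !ler_norml => /andP[? ?] /andP[? ?]; lra.
have den0 : 0 < 1 + d * h + e * h ^+ 2 by rewrite (lt_le_trans _ den).
pose m := (d ^+ 2 - e - n * d) * d + (n - d) * e + (d ^+ 2 - e - n * d) * e * h.
suff [r rC E] : exists2 r : R, `|r| <= C &
    (1 + n * h) / (1 + d * h + e * h ^+ 2) =
      1 + (n - d) * h + (d ^+ 2 - e - n * d) * h ^+ 2 + r * h ^+ 3.
  by exists r => //; exact: le_trans rC (ler_norm _).
exists (- (m * (1 + d * h + e * h ^+ 2)^-1)); last first.
  by rewrite /m; field; rewrite gt_eqF.
rewrite normrN; apply: (normM_le (u' := 2)); last first.
  rewrite ger0_norm; last by rewrite invr_ge0 ltW.
  by rewrite -[leRHS]invrK lef_pV2 ?posrE// invr_gt0.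
rewrite /m expr2.
have B := normB_le (normB_le (normM_le dK dK) eK) (normM_le nK dK).
exact: (normD_le (normD_le (normM_le B dK) (normM_le (normB_le nK dK) eK))
        (normM_le (normM_le B eK) hh)).
Qed.

Lemma dlog_bounds s y : 0 < y ->
  [/\ `|s / (s ^+ 2 + y ^+ 2)| <= y^-1, `|y / (s ^+ 2 + y ^+ 2)| <= y^-1 &
      `|(s ^+ 2 + y ^+ 2)^-1| <= y^-1 ^+ 2].
Proof.
move=> y0; have q0 := sqr_sum_gt0 s y0.
have qn : `|(s ^+ 2 + y ^+ 2)^-1| = (s ^+ 2 + y ^+ 2)^-1.
  by rewrite ger0_norm// invr_ge0 ltW.
rewrite !normrM !qn (gtr0_norm y0); split.
- rewrite ler_pdivrMr// mulrC ler_pdivlMr// -[s ^+ 2]real_normK ?num_real//; nra.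
- rewrite ler_pdivrMr// mulrC ler_pdivlMr//; nra.
- rewrite exprVn lef_pV2 ?posrE// ?lerDr ?sqr_ge0//.
  by rewrite exprn_gt0.
Qed.

(** The coefficient of [h ^+ 2] in the relative expansion of
[poisson (s - a * h) (y + b * h)]. *)
Definition poisson_expansion2 a b s y : R :=
  let q := (s ^+ 2 + y ^+ 2)^-1 in
  let d := 2 * b * y * q - 2 * a * s * q in
  d ^+ 2 - (a ^+ 2 + b ^+ 2) * q - b / y * d.

(** The remainder is relative to the kernel and uniform in [s]: dividing by
[poisson s y] leaves a quotient of two polynomials in [h] whose coefficients are
bounded in terms of [y] alone. *)
Lemma poisson_expansion y : 0 < y -> exists C e : R, [/\ 0 <= C, 0 < e, e <= 1 &
  forall s a b h, `|a| <= 1 -> `|b| <= 1 -> 0 <= h -> h <= e ->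
  [/\ `|a * dlogx s y + b * dlogy s y| <= C,
      `|poisson_expansion2 a b s y| <= C &
  exists2 r : R, `|r| <= C & poisson (s - a * h) (y + b * h) =
    poisson s y * (1 + (a * dlogx s y + b * dlogy s y) * h +
      poisson_expansion2 a b s y * h ^+ 2 + r * h ^+ 3)]].
Proof.
move=> y0.
pose K : R := y^-1 * 4 + 2 * y^-1 ^+ 2.
have yi0 : 0 < y^-1 by rewrite invr_gt0.
have K0 : 0 < K by rewrite addr_gt0// mulr_gt0// exprn_gt0.
have [C C0 HC] := ratio_expansion (ltW K0).
have yK : y^-1 <= K.
  have := sqr_ge0 y^-1; rewrite /K; lra.
exists (C + K + K + (K * K + K + K * K)), (Num.min 1 (Num.min (y / 2) (4 * K)^-1)).
have H1 : 0 <= K + K by lra.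
have H2 : 0 <= K * K + K + K * K by rewrite ?addr_ge0 ?mulr_ge0// ltW.
split => //.
- lra.
- by rewrite !lt_min; apply/and3P; split=> //; rewrite ?divr_gt0 ?invr_gt0// mulr_gt0.
- by rewrite ge_min lexx.
move=> s a b h a1 b1 h0; rewrite !le_min => /and3P[h1 hy hK].
have [sq yq qq] := dlog_bounds s y0.
have q0 := sqr_sum_gt0 s y0.
pose q := (s ^+ 2 + y ^+ 2)^-1.
pose d := 2 * b * y * q - 2 * a * s * q.
pose e := (a ^+ 2 + b ^+ 2) * q.
have nK : `|b / y| <= K.
  apply: (le_trans (normM_le b1 (lexx _))); by rewrite mul1r gtr0_norm.
have l2 : `|2 : R| <= 2 by rewrite ger0_norm.
have dK : `|d| <= K.
  have -> : d = 2 * (b * (y / (s ^+ 2 + y ^+ 2))) - 2 * (a * (s / (s ^+ 2 + y ^+ 2))).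
    by rewrite /d /q; ring.
  apply: le_trans (normB_le (normM_le l2 (normM_le b1 yq))
    (normM_le l2 (normM_le a1 sq))) _.
  rewrite /K; have := sqr_ge0 y^-1; lra.
have eK : `|e| <= K.
  rewrite /e !expr2.
  apply: le_trans (normM_le (normD_le (normM_le a1 a1) (normM_le b1 b1)) qq) _.
  rewrite /K; lra.
have Kh : 4 * K * h <= 1.
  by rewrite mulrC -ler_pdivlMr ?mulr_gt0// div1r.
have [r rC E] := HC _ _ _ _ nK dK eK h0 h1 Kh.
have A : a * dlogx s y + b * dlogy s y = b / y - d.
  by rewrite /d /q /dlogx /dlogy; ring.
have B : poisson_expansion2 a b s y = d ^+ 2 - e - b / y * d by [].
have BK : `|poisson_expansion2 a b s y| <= K * K + K + K * K.
  rewrite B expr2.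
  exact: (normB_le (normB_le (normM_le dK dK) eK) (normM_le nK dK)).
split.
- rewrite A; apply: le_trans (normB_le nK dK) _; lra.
- apply: le_trans BK _; lra.
exists r; first lra.
rewrite A B -E /poisson /d /e /q.
have bh : - (y / 2) <= b * h.
  have := normM_le b1 (lexx `|h|); rewrite mul1r (ger0_norm h0).
  by rewrite ler_norml => /andP[+ _]; lra.
field.
rewrite !gt_eqF//=.
have -> : s ^+ 2 + y ^+ 2 + (2 * b * y - 2 * a * s) * h +
    (a ^+ 2 + b ^+ 2) * h ^+ 2 = (s - a * h) ^+ 2 + (y + b * h) ^+ 2 by ring.
by apply: sqr_sum_gt0; lra.
Qed.

(** The kernel is harmonic: the second order terms cancel in the five-point
difference. *)
Lemma poisson_expansion2_harmonic s y : 0 < y ->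
  poisson_expansion2 1 0 s y + poisson_expansion2 (-1) 0 s y +
  poisson_expansion2 0 1 s y + poisson_expansion2 0 (-1) s y = 0.
Proof.
move=> y0; rewrite /poisson_expansion2; field.
by rewrite !gt_eqF//= sqr_sum_gt0.
Qed.

(** The second order coefficient of the product is that of the sum of the factors
plus the second elementary symmetric function of the first order ones, written
as half of the difference between the square of their sum and the sum of their
squares. *)
Lemma prod_expansion (I : eqType) (s : seq I) (C : R) : 0 <= C ->
  exists2 C' : R, 0 <= C' & forall (f A B r : I -> R) h, 0 <= h -> h <= 1 ->
  (forall i, [/\ `|A i| <= C, `|B i| <= C, `|r i| <= C &
     f i = 1 + A i * h + B i * h ^+ 2 + r i * h ^+ 3]) ->
  let S := \sum_(i <- s) A i in
  let Q := \sum_(i <- s) B i + (S ^+ 2 - \sum_(i <- s) A i ^+ 2) / 2 in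
  [/\ `|S| <= C', `|Q| <= C' & exists2 r' : R, `|r'| <= C' &
    \prod_(i <- s) f i = 1 + S * h + Q * h ^+ 2 + r' * h ^+ 3].
Proof.
move=> C0; elim: s => [|i s [C' C'0 IH]].
  exists 0 => // f A B r h h0 h1 H.
  rewrite /= !big_nil expr2 mulr0 subr0 mul0r addr0 !normr0; split => //.
  by exists 0; rewrite ?normr0 //; ring.
evar (D : (R : Type)); exists (C + C' + (C + C' + C * C') + `|D|).
  by rewrite !addr_ge0 ?mulr_ge0.
move=> f A B r h h0 h1 H.
have [SC QC [r' rC' E]] := IH f A B r h h0 h1 H.
have [Ai Bi ri fi] := H i.
rewrite /= !big_cons E fi.
set S := \sum_(i <- s) _ in SC QC E *.
set Q := _ + _ in QC E *.
have hh : `|h| <= 1 by rewrite ger0_norm.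
have F0 : 0 <= C + C' by rewrite addr_ge0.
have E0 : 0 <= C + C' + C * C' by rewrite addr_ge0// mulr_ge0.
have Qe : B i + \sum_(j <- s) B j +
   ((A i + S) ^+ 2 - (A i ^+ 2 + \sum_(j <- s) A j ^+ 2)) / 2 = B i + Q + A i * S.
  by rewrite /Q; field.
rewrite Qe; split.
- by apply: le_trans (normD_le Ai SC) _; rewrite -addrA lerDl addr_ge0.
- apply: le_trans (normD_le (normD_le Bi QC) (normM_le Ai SC)) _.
  by rewrite -[leRHS]addrA [leRHS]addrCA lerDl addr_ge0.
exists (A i * Q + B i * S + r i + r' + h * (B i * Q + r i * S + A i * r')
  + (h * h) * (r i * Q + B i * r') + (h * h * h) * (r i * r')); last by ring.
apply: (@le_trans _ _ D); last first.
  by apply: le_trans (ler_norm _) _; rewrite lerDr addr_ge0.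
exact: (normD_le (normD_le (normD_le (normD_le (normD_le (normD_le
 (normM_le Ai QC) (normM_le Bi SC)) ri) rC')
 (normM_le hh (normD_le (normD_le (normM_le Bi QC) (normM_le ri SC)) (normM_le Ai rC'))))
 (normM_le (normM_le hh hh) (normD_le (normM_le ri QC) (normM_le Bi rC'))))
 (normM_le (normM_le (normM_le hh hh) hh) (normM_le ri rC'))).
Qed.

End Poisson.

(** * The minimum principle on a rectangle *)

Section MinimumPrinciple.
Context {R : realType}.
Implicit Types (f g : R -> R -> R) (x y : R).

Definition lipschitz_at f x y := exists K e : R, 0 < e /\
  forall a b h, `|a| <= 1 -> `|b| <= 1 -> 0 <= h -> h <= e ->
    `|f (x + a * h) (y + b * h) - f x y| <= K * h.

Definition laplacian_diff f x y h :=
  f (x + h) y + f (x - h) y + f x (y + h) + f x (y - h) - 4 * f x y.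

(** Approximate mean value property at small scales.  An error [o (h ^+ 2)] in the
five-point difference already rules out interior minima after a strictly
superharmonic perturbation; the Lipschitz half provides continuity. *)
Definition harmonic_at f x y := lipschitz_at f x y /\ exists K e : R, 0 < e /\
  forall h, 0 <= h -> h <= e -> `|laplacian_diff f x y h| <= K * h ^+ 3.

Lemma lipschitz_at_continuous f x y : lipschitz_at f x y ->
  {for (x, y), continuous (fun z : R * R => f z.1 z.2)}.
Proof.
move=> [K [e [e0 H]]]; apply/cvgrPdist_le => /= r r0.
pose d := Num.min e (r / (`|K| + 1)).
have K1 : 0 < `|K| + 1 by rewrite ltr_wpDl.
have d0 : 0 < d by rewrite lt_min e0 divr_gt0.
exists (ball x d, ball y d); first by split; exact: nbhsx_ballx.
move=> [x' y'] /= []; rewrite /ball /= => xd yd.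
have unit (c c' : R) : `|c - c'| < d -> `|(c' - c) / d| <= 1.
  by move=> /ltW H1; rewrite normrM distrC normfV (gtr0_norm d0) ler_pdivrMr// mul1r.
have := H _ _ d (unit _ _ xd) (unit _ _ yd) (ltW d0).
rewrite ge_min lexx => /(_ isT).
have back (c c' : R) : c + (c' - c) / d * d = c' by field; rewrite gt_eqF.
rewrite !back distrC => /le_trans; apply.
apply: le_trans (_ : `|K| * d <= r); first by rewrite ler_wpM2r ?ler_norm// ltW.
apply: le_trans (_ : (`|K| + 1) * (r / (`|K| + 1)) <= r).
  by apply: ler_pM => //; rewrite ?ler_wpDr// ?(ltW d0) // /d ge_min lexx orbT.
by rewrite mulrCA divff ?mulr1// gt_eqF.
Qed.

Lemma harmonic_at_lin c f g x y : harmonic_at f x y -> harmonic_at g x y ->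
  harmonic_at (fun x' y' => f x' y' + c * g x' y') x y.
Proof.
move=> [[K1 [e1 [e1_0 H1]]] [K2 [e2 [e2_0 H2]]]].
move=> [[K3 [e3 [e3_0 H3]]] [K4 [e4 [e4_0 H4]]]]; split.
- exists (K1 + `|c| * K3), (Num.min e1 e3); rewrite lt_min e1_0; split => //.
  move=> a b h a1 b1 h0; rewrite le_min => /andP[he1 he3].
  have := normD_le (H1 _ _ _ a1 b1 h0 he1)
    (normM_le (lexx `|c|) (H3 _ _ _ a1 b1 h0 he3)).
  by rewrite mulrDl mulrA; apply: le_trans; rewrite le_eqVlt; apply/orP; left;
    apply/eqP; congr `|_|; ring.
- exists (K2 + `|c| * K4), (Num.min e2 e4); rewrite lt_min e2_0; split => //.
  move=> h h0; rewrite le_min => /andP[he2 he4].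
  have := normD_le (H2 _ h0 he2) (normM_le (lexx `|c|) (H4 _ h0 he4)).
  by rewrite mulrDl mulrA; apply: le_trans; rewrite le_eqVlt; apply/orP; left;
    apply/eqP; congr `|_|; rewrite /laplacian_diff; ring.
Qed.

Lemma rectangle_compact (x0 x1 y0 y1 : R) :
  compact ([set` `[x0, x1]] `*` [set` `[y0, y1]]).
Proof. by apply: compact_setX; exact: segment_compact. Qed.

(** Perturbing [f] by a small multiple of the concave [s] makes its five-point
difference strictly negative at small scales, which is impossible at an interior
minimum; the perturbation is small enough to keep a negative value of [f]. *)
Lemma minimum_principle f x0 x1 y0 y1 :
  (forall x y, x0 <= x <= x1 -> y0 <= y <= y1 -> harmonic_at f x y) ->
  (forall x y, x0 <= x <= x1 -> y0 <= y <= y1 ->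
     [|| x == x0, x == x1, y == y0 | y == y1] -> 0 <= f x y) ->
  forall x y, x0 <= x <= x1 -> y0 <= y <= y1 -> 0 <= f x y.
Proof.
move=> harm bdry u w uI wI; rewrite leNgt; apply/negP => fneg.
pose D := (x1 - x0) ^+ 2 + (y1 - y0) ^+ 2 + 1.
have D0 : 0 < D by rewrite ltr_wpDl// addr_ge0// sqr_ge0.
pose e := - f u w / (2 * D).
have e0 : 0 < e by rewrite divr_gt0 ?oppr_gt0// mulr_gt0.
pose s x y := D - (x - x0) ^+ 2 - (y - y0) ^+ 2.
pose phi (z : R * R) := f z.1 z.2 + e * s z.1 z.2.
pose A := [set` `[x0, x1]] `*` [set` `[y0, y1]].
have inA x y : A (x, y) <-> x0 <= x <= x1 /\ y0 <= y <= y1.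
  by rewrite /A /= !in_itv.
have s_ge0 x y : x0 <= x <= x1 -> y0 <= y <= y1 -> 0 <= s x y <= D.
  move=> /andP[? ?] /andP[? ?]; rewrite /s /D.
  have := sqr_ge0 (x - x0); have := sqr_ge0 (y - y0).
  have : (x - x0) ^+ 2 <= (x1 - x0) ^+ 2 by rewrite lerXn2r ?nnegrE; lra.
  have : (y - y0) ^+ 2 <= (y1 - y0) ^+ 2 by rewrite lerXn2r ?nnegrE; lra.
  lra.
have cphi : {within A, continuous phi}.
  apply: continuous_in_subspaceT => -[x y]; rewrite inE => /inA[xI yI].
  apply: cvgD; first exact/lipschitz_at_continuous/(harm _ _ xI yI).1.
  apply: cvgM; first exact: cvg_cst.
  have cx : {for (x, y), continuous (fun z : R * R => z.1 - x0)}.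
    by apply: cvgB; [exact: cvg_fst|exact: cvg_cst].
  have cy : {for (x, y), continuous (fun z : R * R => z.2 - y0)}.
    by apply: cvgB; [exact: cvg_snd|exact: cvg_cst].
  rewrite /s; apply: cvgB; last exact: (cvgM cy cy).
  by apply: cvgB; [exact: cvg_cst|exact: (cvgM cx cx)].
have A0 : A !=set0 by exists (u, w); exact/inA.
have [[a b]] := compact_EVT_min A0 (@rectangle_compact _ _ _ _) cphi.
rewrite inE => /inA[aI bI] amin.
have phi_min x y : x0 <= x <= x1 -> y0 <= y <= y1 -> phi (a, b) <= phi (x, y).
  by move=> xI yI; apply: amin; rewrite inE; exact/inA.
have phi_neg : phi (a, b) < 0.
  apply: le_lt_trans (phi_min _ _ uI wI) _; rewrite /phi /=.
  have /andP[_ sD] := s_ge0 _ _ uI wI.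
  have : e * s u w <= e * D by rewrite ler_wpM2l// ltW.
  have -> : e * D = - f u w / 2 by rewrite /e; field; rewrite gt_eqF.
  lra.
have interior : [&& x0 < a, a < x1, y0 < b & b < y1].
  have : ~~ [|| a == x0, a == x1, b == y0 | b == y1].
    apply/negP => /(bdry _ _ aI bI) fab.
    have /andP[sab _] := s_ge0 _ _ aI bI.
    have := mulr_ge0 (ltW e0) sab; move: phi_neg; rewrite /phi /=; lra.
  rewrite !negb_or => /and4P[? ? ? ?]; move/andP: aI => [? ?]; move/andP: bI => [? ?].
  by rewrite !lt_neqAle; apply/and4P; split; apply/andP; split => //; rewrite eq_sym.
have [_ [K [d [d0 HK]]]] := harm _ _ aI bI.
move/and4P: interior => [ax0 ax1 by0 by1].
(* A step that stays in the rectangle and for which the error [K * h ^+ 3] is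
beaten by the contribution [4 * e * h ^+ 2] of the perturbation. *)
pose h := Num.min d (Num.min (Num.min (a - x0) (x1 - a))
  (Num.min (Num.min (b - y0) (y1 - b)) (e / (`|K| + 1)))).
have K1 : 0 < `|K| + 1 by rewrite ltr_wpDl.
have h0 : 0 < h by rewrite !lt_min d0 !subr_gt0 ax0 ax1 by0 by1 divr_gt0.
have : h <= h by []; rewrite {2}/h !le_min.
move=> /and4P[hd /andP[h1 h2] /andP[h3 h4] hK].
move: aI bI => /andP[? ?] /andP[? ?].
have m1 : phi (a, b) <= phi (a + h, b) by apply: phi_min; lra.
have m2 : phi (a, b) <= phi (a - h, b) by apply: phi_min; lra.
have m3 : phi (a, b) <= phi (a, b + h) by apply: phi_min; lra.
have m4 : phi (a, b) <= phi (a, b - h) by apply: phi_min; lra.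
have L : 4 * e * h ^+ 2 <= laplacian_diff f a b h.
  move: m1 m2 m3 m4; rewrite /phi /laplacian_diff /s /= => *; lra.
have := HK _ (ltW h0) hd; rewrite ler_norml => /andP[_ U].
have KU : K * h ^+ 3 <= e * h ^+ 2.
  rewrite exprS mulrA ler_wpM2r ?sqr_ge0//.
  apply: le_trans (_ : (`|K| + 1) * h <= e).
    by rewrite ler_wpM2r// ?(ltW h0)// (le_trans (ler_norm _))// lerDl.
  by rewrite mulrC -ler_pdivlMr.
have : 0 < e * h ^+ 2 by rewrite mulr_gt0// exprn_gt0.
lra.
Qed.

End MinimumPrinciple.

(** * Harmonic barriers *)

Section Barriers.
Context {R : realType}.
Implicit Types (f g : R -> R -> R) (x y : R).

Lemma harmonic_at_cst (c : R) x y : harmonic_at (fun _ _ => c) x y.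
Proof.
by split; exists 0, 1; split => // *; rewrite ?/laplacian_diff mul0r normr_le0;
  apply/eqP; ring.
Qed.

Lemma harmonic_at_snd x y : harmonic_at (fun _ y' => y') x y.
Proof.
split; last first.
  by exists 0, 1; split => // *; rewrite /laplacian_diff mul0r normr_le0; apply/eqP; ring.
exists 1, 1; split => // a b h a1 b1 h0 h1.
by rewrite addrAC subrr add0r normrM (ger0_norm h0) ler_wpM2r.
Qed.

Lemma harmonic_at_shift f c x y : harmonic_at f x (y + c) ->
  harmonic_at (fun x' y' => f x' (y' + c)) x y.
Proof.
move=> [[K [e [e0 H]]] [K' [e' [e'0 H']]]]; split.
- exists K, e; split => // a b h a1 b1 h0 he; rewrite addrAC; exact: H.
- exists K', e'; split => // h h0 he.
  by rewrite /laplacian_diff (addrAC y h) (addrAC y (- h)); exact: H'.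
Qed.

(** The harmonic polynomial [Im (- w ^+ 3)] for [w = x + i y]. *)
Definition cubic x y : R := y ^+ 3 - 3 * x ^+ 2 * y.

Lemma harmonic_at_cubic x y : harmonic_at cubic x y.
Proof.
split; last first.
  exists 0, 1; split => // h _ _; rewrite mul0r normr_le0 /laplacian_diff /cubic.
  by apply/eqP; ring.
evar (K : (R : Type)); exists K, 1; split => // a b h a1 b1 h0 h1.
have hh : `|h| <= 1 by rewrite ger0_norm.
have -> : cubic (x + a * h) (y + b * h) - cubic x y =
  ((3 * y ^+ 2) * b + (3 * y) * (b * b) * h + b * b * b * h * h
    - (6 * x * y) * a - (3 * x ^+ 2) * b - (3 * y) * (a * a) * h
    - (6 * x) * (a * b) * h - 3 * (a * a * b) * h * h) * h.
  by rewrite /cubic; ring.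
rewrite normrM (ger0_norm h0) ler_wpM2r//.
have N (u : R) : `|u| <= `|u| by [].
exact: (normB_le (normB_le (normB_le (normB_le (normB_le (normD_le (normD_le
  (normM_le (N _) b1) (normM_le (normM_le (N _) (normM_le b1 b1)) hh))
  (normM_le (normM_le (normM_le (normM_le b1 b1) b1) hh) hh))
  (normM_le (N _) a1)) (normM_le (N _) b1))
  (normM_le (normM_le (N _) (normM_le a1 a1)) hh))
  (normM_le (normM_le (N _) (normM_le a1 b1)) hh))
  (normM_le (normM_le (normM_le (N _) (normM_le (normM_le a1 a1) b1)) hh) hh)).
Qed.

Lemma harmonic_at_poisson x y : 0 < y -> harmonic_at (@poisson R) x y.
Proof.
move=> y0; have [C [e [C0 e0 e1 H]]] := poisson_expansion y0.
have p0 := poisson_gt0 x y0.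
split.
- exists (poisson x y * (3 * C)), e; split => // a b h a1 b1 h0 he.
  have am : `|- a| <= 1 by rewrite normrN.
  have [AC BC [r rC]] := H x (- a) b h am b1 h0 he.
  rewrite mulNr opprK => ->.
  move: AC BC; set A := _ + _; set B := poisson_expansion2 _ _ _ _ => AC BC.
  rewrite (_ : _ - _ = poisson x y * (A + B * h + r * (h * h)) * h); last by ring.
  rewrite normrM (ger0_norm h0) ler_wpM2r// normrM (gtr0_norm p0) ler_wpM2l ?(ltW p0)//.
  have hh : `|h| <= 1 by rewrite ger0_norm// (le_trans he).
  apply: le_trans (normD_le (normD_le AC (normM_le BC hh))
    (normM_le rC (normM_le hh hh))) _.
  by rewrite !mulr1 (_ : 3 * C = C + C + C)//; ring.
exists (poisson x y * (4 * C)), e; split => // h h0 he.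
have dir a b x' y' : `|a| <= 1 -> `|b| <= 1 -> x' = x - a * h -> y' = y + b * h ->
    exists2 r : R, `|r| <= C & poisson x' y' =
    poisson x y * (1 + (a * dlogx x y + b * dlogy x y) * h +
      poisson_expansion2 a b x y * h ^+ 2 + r * h ^+ 3).
  by move=> a1 b1 -> ->; have [_ _] := H x a b h a1 b1 h0 he.
rewrite /laplacian_diff.
have [r1 r1C ->] := dir (-1) 0 (x + h) y ltac:(by rewrite normrN1)
    ltac:(by rewrite normr0) ltac:(ring) ltac:(ring).
have [r2 r2C ->] := dir 1 0 (x - h) y ltac:(by rewrite normr1)
    ltac:(by rewrite normr0) ltac:(ring) ltac:(ring).
have [r3 r3C ->] := dir 0 1 x (y + h) ltac:(by rewrite normr0)
    ltac:(by rewrite normr1) ltac:(ring) ltac:(ring).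
have [r4 r4C ->] := dir 0 (-1) x (y - h) ltac:(by rewrite normr0)
    ltac:(by rewrite normrN1) ltac:(ring) ltac:(ring).
have := poisson_expansion2_harmonic x y0.
set P1 := poisson_expansion2 1 0 x y; set P2 := poisson_expansion2 (-1) 0 x y.
set P3 := poisson_expansion2 0 1 x y; set P4 := poisson_expansion2 0 (-1) x y => P0.
have -> : P4 = P1 + P2 + P3 + P4 - (P1 + P2 + P3) by ring.
rewrite P0 sub0r.
rewrite (_ : _ - _ = poisson x y * (r1 + r2 + r3 + r4) * h ^+ 3); last by ring.
rewrite normrM (ger0_norm (exprn_ge0 3 h0)) ler_wpM2r ?exprn_ge0//.
rewrite normrM (gtr0_norm p0) ler_wpM2l ?(ltW p0)//.
apply: le_trans (normD_le (normD_le (normD_le r1C r2C) r3C) r4C) _.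
by rewrite (_ : 4 * C = C + C + C + C)//; ring.
Qed.

End Barriers.

(** * Poisson integrals on diagonal complex lines *)

Section PoissonIntegral.
Context {R : realType} {n : nat}.
Variable mu : {measure set borelRn R n -> \bar R}.
Hypothesis growth : growth_condition mu.
Hypothesis nev : nevanlinna_condition mu.
Implicit Types (tau : 'rV[R]_n) (t : borelRn R n) (x y : R).

Definition coord (j : 'I_n) (t : borelRn R n) : R := (t : 'rV[R]_n) 0 j.

Lemma continuous_measurable_borelRn (f : 'rV[R]_n -> R) :
  continuous f -> measurable_fun setT (f : borelRn R n -> R).
Proof.
move=> /continuousP cf.
apply: (measurability _ (measurable_realfun.RGenOpens.measurableE R)).
move=> _ [_ [a [b ->] <-]]; rewrite setTI; apply: sub_sigma_algebra.
by apply: cf; exact: interval_open.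
Qed.

Lemma measurable_coord j : measurable_fun setT (coord j).
Proof. by apply: continuous_measurable_borelRn; exact: coord_continuous. Qed.

Lemma measurable_inv_sqr_sum (f : borelRn R n -> R) y : 0 < y ->
  measurable_fun setT f -> measurable_fun setT (fun t => (f t ^+ 2 + y ^+ 2)^-1).
Proof.
move=> y0 mf.
suff mq : measurable_fun setT (fun s : R => (s ^+ 2 + y ^+ 2)^-1).
  exact: (measurableT_comp mq mf).
apply: continuous_measurable_fun => s; apply: cvgV.
  by rewrite gt_eqF// sqr_sum_gt0.
by apply: cvgD; [exact: exprn_continuous|exact: cvg_cst].
Qed.

Definition centred tau x j t : R := coord j t - tau 0 j - x.

(** The product Poisson kernel at the point with coordinates
[tau 0 j + x + i y]. *)
Definition poissonprod tau x y t : R := \prod_(j < n) poisson (centred tau x j t) y.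

Lemma measurable_centred tau x j : measurable_fun setT (centred tau x j).
Proof.
by do 2 apply: measurable_funB => //; exact: measurable_coord.
Qed.

Lemma measurable_poisson tau x y j : 0 < y ->
  measurable_fun setT (fun t => poisson (centred tau x j t) y).
Proof.
move=> y0; apply: measurable_funM => //.
by apply: measurable_inv_sqr_sum => //; exact: measurable_centred.
Qed.

Lemma measurable_poissonprod tau x y : 0 < y -> measurable_fun setT (poissonprod tau x y).
Proof. by move=> y0; apply: measurable_prod => j _; exact: measurable_poisson. Qed.

Lemma poissonprod_gt0 tau x y t : 0 < y -> 0 < poissonprod tau x y t.
Proof. by move=> y0; apply: prodr_gt0 => j _; exact: poisson_gt0. Qed.

Definition Rintegrable (f : borelRn R n -> R) := mu.-integrable setT (EFin \o f).

Lemma Rintegrable_dominated (f g : borelRn R n -> R) C : Rintegrable g ->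
  measurable_fun setT f -> (forall t, `|f t| <= C * g t) -> Rintegrable f.
Proof.
move=> ig mf fg; apply: (le_integrable _ _ _ (integrableZl _ C ig)) => //.
  exact/measurable_EFinP.
by move=> t _; rewrite /= lee_fin (le_trans (fg t))// ler_norm.
Qed.

Lemma Rintegrable_scale c (f : borelRn R n -> R) :
  Rintegrable f -> Rintegrable (fun t => c * f t).
Proof. by move=> H; exact: (integrableZl _ c H). Qed.

Lemma Rintegrable_add (f g : borelRn R n -> R) :
  Rintegrable f -> Rintegrable g -> Rintegrable (fun t => f t + g t).
Proof. by move=> Hf Hg; exact: (integrableD measurableT Hf Hg). Qed.

Lemma Rintegrable_sub (f g : borelRn R n -> R) :
  Rintegrable f -> Rintegrable g -> Rintegrable (fun t => f t - g t).
Proof. by move=> Hf Hg; exact: (integrableB measurableT Hf Hg). Qed.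

Lemma Rintegrable_abs (f : borelRn R n -> R) :
  Rintegrable f -> Rintegrable (fun t => `|f t|).
Proof. by move=> Hf; exact: (integrable_abse Hf). Qed.

(** Each factor is bounded by a multiple of [1 / (1 + t_j ^+ 2)]. *)
Lemma Rintegrable_poissonprod tau x y : 0 < y -> Rintegrable (poissonprod tau x y).
Proof.
move=> y0.
pose G t : R := \prod_(l < n) (1 / (1 + coord l t ^+ 2)).
have mG : measurable_fun setT G.
  apply: measurable_prod => l _; apply: measurable_funM => //.
  under eq_fun do rewrite addrC -[X in _ + X](expr1n _ 2).
  by apply: measurable_inv_sqr_sum => //; exact: measurable_coord.
have q1 l t : 0 < 1 + coord l t ^+ 2 by rewrite ltr_wpDr// sqr_ge0.
have G0 t : 0 <= G t by apply: prodr_ge0 => l _; rewrite divr_ge0// ltW.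
have iG : Rintegrable G.
  apply/integrableP; split; first exact/measurable_EFinP.
  under eq_integral do rewrite /= ger0_norm//.
  exact: growth.
pose c j := tau 0 j + x.
pose M j := y * (2 + (1 + 2 * c j ^+ 2) / y ^+ 2).
apply: (Rintegrable_dominated (C := \prod_(j < n) M j) iG).
  exact: measurable_poissonprod.
move=> t; rewrite gtr0_norm ?poissonprod_gt0// /G -big_split/=.
apply: ler_prod => j _; rewrite (ltW (poisson_gt0 _ y0))/= /M /poisson.
have Q := sqr_sum_gt0 (centred tau x j t) y0.
rewrite div1r ler_pdivrMr// mulrAC ler_pdivlMr// -mulrA ler_wpM2l ?(ltW y0)//.
have -> : centred tau x j t = coord j t - c j by rewrite /centred /c; ring.
set s := coord j t; set u := c j.
have y2 : 0 < y ^+ 2 by rewrite exprn_gt0.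
have -> : (2 + (1 + 2 * u ^+ 2) / y ^+ 2) * ((s - u) ^+ 2 + y ^+ 2) =
  2 * (s - u) ^+ 2 + 2 * y ^+ 2 + (1 + 2 * u ^+ 2) / y ^+ 2 * (s - u) ^+ 2
  + 1 + 2 * u ^+ 2 by field; rewrite gt_eqF.
have : 0 <= (1 + 2 * u ^+ 2) / y ^+ 2 * (s - u) ^+ 2.
  by rewrite mulr_ge0 ?sqr_ge0// divr_ge0 ?sqr_ge0// addr_ge0// mulr_ge0// sqr_ge0.
have := sqr_ge0 (s - 2 * u); nra.
Qed.

Definition poissonint tau x y : R := \int[mu]_t poissonprod tau x y t.

Lemma poissonint_ge0 tau x y : 0 < y -> 0 <= poissonint tau x y.
Proof. by move=> y0; apply: Rintegral_ge0 => t _; rewrite ltW// poissonprod_gt0. Qed.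

Lemma poissonint_le c tau x y tau' x' y' : 0 < y -> 0 < y' ->
  (forall j s, poisson (s - tau 0 j - x) y <= c * poisson (s - tau' 0 j - x') y') ->
  poissonint tau x y <= c ^+ n * poissonint tau' x' y'.
Proof.
move=> y0 y'0 H; rewrite /poissonint -RintegralZl//; last exact: Rintegrable_poissonprod.
apply: le_Rintegral => //.
- exact: Rintegrable_poissonprod.
- by apply: Rintegrable_scale; exact: Rintegrable_poissonprod.
move=> t _; rewrite /poissonprod -[X in c ^+ X]card_ord -prodr_const -big_split/=.
by apply: ler_prod => j _; rewrite (ltW (poisson_gt0 _ y0))/= H.
Qed.

(** On the cube each factor of the kernel is at least [1 / (2 * y)]. *)
Lemma measure_open_cube_le tau y : 0 < y ->
  (mu (open_cube tau y) <= ((2 * y) ^+ n * poissonint tau 0 y)%:E)%E.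
Proof.
move=> y0.
have mD : measurable (open_cube tau y).
  have -> : open_cube tau y = ball tau y.
    apply/seteqP; split => t H.
      by split => // i j; rewrite (ord1 i); exact: H.
    by move=> j; exact: H.2.
  by apply: sub_sigma_algebra; exact: ball_open.
have iK := Rintegrable_poissonprod tau 0 y0.
rewrite /poissonint -RintegralZl// fineK; last first.
  by apply: integrable_fin_num => //; exact: Rintegrable_scale.
rewrite -[mu _]mul1e -integral_cst//.
apply: le_trans (_ : \int[mu]_(t in open_cube tau y)
    ((2 * y) ^+ n * poissonprod tau 0 y t)%:E <= _)%E; last first.
  apply: ge0_subset_integral => //.
    apply/measurable_EFinP; apply: measurable_funM => //.
    exact: measurable_poissonprod.
  move=> t _; rewrite lee_fin mulr_ge0 ?(ltW (poissonprod_gt0 _ _ _ y0))//.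
  by rewrite exprn_ge0// mulr_ge0// ltW.
apply: ge0_le_integral => //.
- apply: measurable_funTS; apply/measurable_EFinP; apply: measurable_funM => //.
  exact: measurable_poissonprod.
move=> t Dt; rewrite lee_fin /poissonprod -[X in _ ^+ X]card_ord.
rewrite -prodr_const -big_split/=.
apply: le_trans (_ : \prod_(j < n) 1 <= _); first by rewrite big1_eq.
apply: ler_prod => j _; rewrite ler01/= /poisson mulrA ler_pdivlMr ?sqr_sum_gt0//.
have := Dt j; rewrite /centred subr0 distrC ltr_norml => /andP[H1 H2].
rewrite mul1r /coord.
move: H1 H2; set s : R := _ - _ => H1 H2.
nra.
Qed.

(** * The Nevanlinna condition and harmonicity *)

Local Open Scope complex_scope.

(** The reciprocal squares in the Nevanlinna condition are, up to factors [2 i]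
and [- 2 i], the complex derivatives of the Poisson kernel in [z] and in its
conjugate. *)
Lemma inv_sqr_complex (s y : R) : 0 < y ->
  ((s +i* (- y)) ^+ 2)^-1 = (poisson s y)%:C * (dlogy s y +i* dlogx s y) /\
  ((s +i* y) ^+ 2)^-1 = (poisson s y)%:C * (dlogy s y +i* (- dlogx s y)).
Proof.
move=> y0; have q0 := sqr_sum_gt0 s y0.
by split; apply: mulr1_eq; rewrite /poisson /dlogy /dlogx expr2; simpc;
  apply/eqP; rewrite eq_complex /=; apply/andP; split; apply/eqP; field;
  rewrite ?gt_eqF.
Qed.

Lemma inv_sub_conj_complex (s y : R) : 0 < y ->
  1 / (s +i* (- y)) - 1 / (s +i* y) = (0 +i* 2) * (poisson s y)%:C.
Proof.
move=> y0; have q0 := sqr_sum_gt0 s y0.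
rewrite !div1r.
have -> : (s +i* (- y))^-1 = (s / (s ^+ 2 + y ^+ 2)) +i* (y / (s ^+ 2 + y ^+ 2)).
  apply: mulr1_eq; simpc; apply/eqP; rewrite eq_complex /=.
  by apply/andP; split; apply/eqP; field; rewrite ?gt_eqF.
have -> : (s +i* y)^-1 = (s / (s ^+ 2 + y ^+ 2)) +i* (- y / (s ^+ 2 + y ^+ 2)).
  apply: mulr1_eq; simpc; apply/eqP; rewrite eq_complex /=.
  by apply/andP; split; apply/eqP; field; rewrite ?gt_eqF.
rewrite /poisson; simpc; apply/eqP; rewrite eq_complex /=.
by apply/andP; split; apply/eqP; field; rewrite ?gt_eqF.
Qed.

Definition dlogx_at tau x y j t : R := dlogx (centred tau x j t) y.
Definition dlogy_at tau x y j t : R := dlogy (centred tau x j t) y.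

Lemma measurable_dlogx_at tau x y j : 0 < y ->
  measurable_fun setT (dlogx_at tau x y j).
Proof.
move=> y0; apply: measurable_funM.
  by apply: measurable_funM => //; exact: measurable_centred.
by apply: measurable_inv_sqr_sum => //; exact: measurable_centred.
Qed.

Lemma measurable_dlogy_at tau x y j : 0 < y ->
  measurable_fun setT (dlogy_at tau x y j).
Proof.
move=> y0; apply: measurable_funB => //; apply: measurable_funM => //.
by apply: measurable_inv_sqr_sum => //; exact: measurable_centred.
Qed.

Lemma dlog_at_le y : 0 < y -> exists C : R, forall tau x j t,
  `|dlogx_at tau x y j t| <= C /\ `|dlogy_at tau x y j t| <= C.
Proof.
move=> y0; have [C [e [C0 e0 e1 H]]] := poisson_expansion y0.
exists C => tau x j t; split.
- have [||||+ _ _] := H (centred tau x j t) 1 0 0; rewrite ?normr1 ?normr0 ?(ltW e0)//.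
  by rewrite mul1r mul0r addr0.
- have [||||+ _ _] := H (centred tau x j t) 0 1 0; rewrite ?normr1 ?normr0 ?(ltW e0)//.
  by rewrite mul1r mul0r add0r.
Qed.

Lemma Rintegrable_poissonprodM tau x y (u : borelRn R n -> R) (C : R) : 0 < y ->
  measurable_fun setT u -> (forall t, `|u t| <= C) ->
  Rintegrable (fun t => poissonprod tau x y t * u t).
Proof.
move=> y0 mu_ uC.
apply: (Rintegrable_dominated (C := C) (Rintegrable_poissonprod tau x y0)).
  by apply: measurable_funM => //; exact: measurable_poissonprod.
move=> t; rewrite normrM mulrC (gtr0_norm (poissonprod_gt0 _ _ _ y0)) ler_wpM2r//.
by rewrite ltW// poissonprod_gt0.
Qed.

(** Four times the real part of [d_i p * dbar_j p / p ^+ 2], in terms of the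
logarithmic derivatives of the two factors. *)
Definition cross tau x y i j t : R :=
  dlogx_at tau x y i t * dlogx_at tau x y j t +
  dlogy_at tau x y i t * dlogy_at tau x y j t.

Lemma Rintegrable_cross tau x y i j : 0 < y ->
  Rintegrable (fun t => poissonprod tau x y t * cross tau x y i j t).
Proof.
move=> y0; have [C HC] := dlog_at_le y0.
apply: (Rintegrable_poissonprodM _ _ (C := C * C + C * C)) => //.
- by apply: measurable_funD; apply: measurable_funM;
    (exact: measurable_dlogx_at || exact: measurable_dlogy_at).
- by move=> t; have [? ?] := HC tau x i t; have [? ?] := HC tau x j t;
    apply: normD_le; exact: normM_le.
Qed.

(** The Nevanlinna integrand with all [z_l - tau_l] equal to [x + i y] is a power
[c] of [2 i] times a complex number with real part [poissonprod * cross]; [c]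
being either real or imaginary, both the real and imaginary parts of the
condition are needed to isolate this real part. *)
Lemma Rintegral_cross_lt tau x y (i j : 'I_n) : 0 < y -> (i < j)%N ->
  \int[mu]_t (poissonprod tau x y t * cross tau x y i j t) = 0.
Proof.
move=> y0 ij.
pose H t := dlogx_at tau x y i t * dlogy_at tau x y j t -
            dlogy_at tau x y i t * dlogx_at tau x y j t.
have [C HC] := dlog_at_le y0.
have iG := Rintegrable_cross tau x i j y0.
have iH : Rintegrable (fun t => poissonprod tau x y t * H t).
  apply: (Rintegrable_poissonprodM _ _ (C := C * C + C * C)) => //.
  - by apply: measurable_funB; apply: measurable_funM;
      (exact: measurable_dlogx_at || exact: measurable_dlogy_at).
  - by move=> t; have [? ?] := HC tau x i t; have [? ?] := HC tau x j t;
      apply: normB_le; exact: normM_le.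
pose z : 'rV[R[i]]_n := \row_l ((tau 0 l + x) +i* y).
have z0 l : 0 < complex.Im (z 0 l) by rewrite mxE.
pose c : R[i] := \prod_(l < n | (l != i) && (l != j)) (0 +i* 2).
have c_neq0 : c != 0.
  by apply/prodf_neq0 => l _; rewrite eq_complex /= negb_and pnatr_eq0 orbT.
have F t : 1 / (((coord i t)%:C - z 0 i) ^+ 2 * ((coord j t)%:C - (z 0 j)^*) ^+ 2) *
    \prod_(l < n | (l != i) && (l != j))
      (1 / ((coord l t)%:C - z 0 l) - 1 / ((coord l t)%:C - (z 0 l)^*)) =
    c * ((poissonprod tau x y t * cross tau x y i j t) +i*
         (poissonprod tau x y t * H t)).
  have zE l : (coord l t)%:C - z 0 l = centred tau x l t +i* (- y).
    rewrite mxE; apply/eqP; rewrite eq_complex /= /centred.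
    by apply/andP; split; apply/eqP; ring.
  have zcE l : (coord l t)%:C - (z 0 l)^* = centred tau x l t +i* y.
    rewrite mxE; apply/eqP; rewrite eq_complex /= /centred.
    by apply/andP; split; apply/eqP; ring.
  under eq_bigr => l _ do rewrite zE zcE inv_sub_conj_complex//.
  rewrite big_split /= -/c zE zcE div1r invfM.
  rewrite (inv_sqr_complex _ y0).1 (inv_sqr_complex _ y0).2 -rmorph_prod /=.
  set P := \prod_(l < n | _) _.
  have -> : poissonprod tau x y t = poisson (centred tau x i t) y *
      (poisson (centred tau x j t) y * P).
    by rewrite /poissonprod (bigD1 i)//= (bigD1 j)//= gt_eqF.
  rewrite mulrCA; congr (c * _); rewrite /cross /H /dlogx_at /dlogy_at; simpc.
  by apply/eqP; rewrite eq_complex /=; apply/andP; split; apply/eqP; ring.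
have := nev z0 ij; rewrite /cintegral.
under [X in X +i* _]eq_Rintegral do rewrite F.
under [X in _ +i* X]eq_Rintegral do rewrite F.
case: c c_neq0 {F} => [a b] c_neq0 /=.
rewrite RintegralB ?RintegralD ?RintegralZl//; try exact: Rintegrable_scale.
set IG := \int[mu]_t _; set IH := \int[mu]_t _.
move=> /eqP; rewrite eq_complex /= => /andP[/eqP re0 /eqP im0].
have : (a ^+ 2 + b ^+ 2) * IG = 0.
  have -> : (a ^+ 2 + b ^+ 2) * IG =
      a * (a * IG - b * IH) + b * (a * IH + b * IG) by ring.
  by rewrite re0 im0 !mulr0 addr0.
move=> /eqP; rewrite mulf_eq0 => /orP[|/eqP //].
rewrite paddr_eq0 ?sqr_ge0// !sqrf_eq0 => /andP[/eqP a0 /eqP b0].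
by move: c_neq0; rewrite a0 b0 eqxx.
Qed.

Lemma Rintegral_cross tau x y (i j : 'I_n) : 0 < y -> j != i ->
  \int[mu]_t (poissonprod tau x y t * cross tau x y i j t) = 0.
Proof.
move=> y0; rewrite neq_ltn orbC => /orP[|] ij; first exact: Rintegral_cross_lt.
rewrite -[RHS](Rintegral_cross_lt tau x y0 ij).
by apply: eq_Rintegral => t _; rewrite /cross; ring.
Qed.

(** Twice the second order coefficient that [prod_expansion] adds to the sum of
those of the factors, totalled over the two coordinate directions. *)
Definition offdiag tau x y t : R :=
  (\sum_(i < n) dlogx_at tau x y i t) ^+ 2 - \sum_(i < n) dlogx_at tau x y i t ^+ 2 +
  ((\sum_(i < n) dlogy_at tau x y i t) ^+ 2 - \sum_(i < n) dlogy_at tau x y i t ^+ 2).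

Lemma offdiagE tau x y t :
  offdiag tau x y t = \sum_(i < n) \sum_(j < n | j != i) cross tau x y i j t.
Proof.
have sq (f : 'I_n -> R) : (\sum_(i < n) f i) ^+ 2 - \sum_(i < n) f i ^+ 2 =
    \sum_(i < n) \sum_(j < n | j != i) f i * f j.
  rewrite expr2 mulr_suml -sumrB; apply: eq_bigr => i _.
  by rewrite (bigD1 i)//= mulrDr expr2 addrC addKr mulr_sumr.
rewrite /offdiag !sq -big_split/=; apply: eq_bigr => i _.
by rewrite -big_split.
Qed.

Lemma Rintegral_sum0 (I : Type) (s : seq I) (P : pred I) (f : I -> borelRn R n -> R) :
  (forall i, P i -> Rintegrable (f i)) -> (forall i, P i -> \int[mu]_t f i t = 0) ->
  Rintegrable (fun t => \sum_(i <- s | P i) f i t) /\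
  \int[mu]_t (\sum_(i <- s | P i) f i t) = 0.
Proof.
move=> fi f0; elim: s => [|i s [IH1 IH2]].
  split; first by under [X in Rintegrable X]eq_fun do rewrite big_nil; exact: integrable0.
  by under eq_Rintegral do rewrite big_nil; rewrite Rintegral_cst// mul0r.
have [Pi|Pi] := boolP (P i); last first.
  have E : (fun t => \sum_(k <- i :: s | P k) f k t) = fun t => \sum_(k <- s | P k) f k t.
    by apply/funext => t; rewrite big_cons (negbTE Pi).
  by rewrite E.
have -> : (fun t => \sum_(k <- i :: s | P k) f k t) =
    fun t => f i t + \sum_(k <- s | P k) f k t.
  by apply/funext => t; rewrite big_cons Pi.
split; first by apply: (Rintegrable_add (fi i Pi) IH1).
by rewrite RintegralD// ?IH2 ?f0 ?addr0//; exact: fi.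
Qed.

Lemma Rintegral_offdiag tau x y : 0 < y ->
  Rintegrable (fun t => poissonprod tau x y t * offdiag tau x y t) /\
  \int[mu]_t (poissonprod tau x y t * offdiag tau x y t) = 0.
Proof.
move=> y0.
have -> : (fun t => poissonprod tau x y t * offdiag tau x y t) =
  fun t => \sum_(i < n) \sum_(j < n | j != i) poissonprod tau x y t * cross tau x y i j t.
  apply/funext => t; rewrite offdiagE mulr_sumr; apply: eq_bigr => i _.
  by rewrite mulr_sumr.
have H i := @Rintegral_sum0 _ (index_enum 'I_n) (fun j => j != i)
  (fun j t => poissonprod tau x y t * cross tau x y i j t)
  (fun j _ => Rintegrable_cross tau x i j y0)
  (fun j ij => Rintegral_cross tau x y0 ij).
exact: (@Rintegral_sum0 _ (index_enum 'I_n) xpredT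
  (fun i t => \sum_(j < n | j != i) poissonprod tau x y t * cross tau x y i j t)
  (fun i _ => (H i).1) (fun i _ => (H i).2)).
Qed.

(** Uniformity in [t] of the expansion of each factor carries over to the
product. *)
Lemma poissonprod_expansion y : 0 < y -> exists C e : R, [/\ 0 <= C, 0 < e, e <= 1 &
  forall tau x t a b h, `|a| <= 1 -> `|b| <= 1 -> 0 <= h -> h <= e ->
  let S := \sum_(i < n) (a * dlogx_at tau x y i t + b * dlogy_at tau x y i t) in
  let Q := \sum_(i < n) poisson_expansion2 a b (centred tau x i t) y +
    (S ^+ 2 - \sum_(i < n)
       (a * dlogx_at tau x y i t + b * dlogy_at tau x y i t) ^+ 2) / 2 in
  [/\ `|S| <= C, `|Q| <= C & exists2 r : R, `|r| <= C &
    poissonprod tau (x + a * h) (y + b * h) t =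
    poissonprod tau x y t * (1 + S * h + Q * h ^+ 2 + r * h ^+ 3)]].
Proof.
move=> y0; have [C [e [C0 e0 e1 H]]] := poisson_expansion y0.
have [C' C'0 H'] := prod_expansion (index_enum 'I_n) C0.
exists C', e; split => // tau x t a b h a1 b1 h0 he.
have h1 : h <= 1 by exact: le_trans he e1.
pose s i := centred tau x i t.
have /choice[r Hr] (i : 'I_n) : exists r : R, `|r| <= C /\
    poisson (s i - a * h) (y + b * h) = poisson (s i) y *
      (1 + (a * dlogx (s i) y + b * dlogy (s i) y) * h +
        poisson_expansion2 a b (s i) y * h ^+ 2 + r * h ^+ 3).
  by have [_ _ [r rC E]] := H (s i) a b h a1 b1 h0 he; exists r.
have := H' (fun i => 1 + (a * dlogx (s i) y + b * dlogy (s i) y) * h +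
        poisson_expansion2 a b (s i) y * h ^+ 2 + r i * h ^+ 3)
  (fun i => a * dlogx (s i) y + b * dlogy (s i) y)
  (fun i => poisson_expansion2 a b (s i) y) r h h0 h1.
case=> [i|SC QC [r' rC E]].
  by have [? ? _] := H (s i) a b h a1 b1 h0 he; split => //; exact: (Hr i).1.
split => //; exists r' => //; rewrite -E /poissonprod -big_split/=.
apply: eq_bigr => i _; rewrite -(Hr i).2; congr poisson.
by rewrite /s /centred; ring.
Qed.

Lemma poissonint_lipschitz tau x y : 0 < y -> lipschitz_at (poissonint tau) x y.
Proof.
move=> y0; have [C [e [C0 e0 e1 H]]] := poissonprod_expansion y0.
have iK := Rintegrable_poissonprod tau x y0.
exists (3 * C * poissonint tau x y), (Num.min e (y / 2)).
rewrite lt_min e0 divr_gt0//; split => // a b h a1 b1 h0; rewrite le_min => /andP[he hy].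
have yb0 : 0 < y + b * h.
  have := normM_le b1 (lexx `|h|).
  by rewrite mul1r (ger0_norm h0) ler_norml => /andP[+ _]; lra.
have iK' := Rintegrable_poissonprod tau (x + a * h) yb0.
have -> : 3 * C * poissonint tau x y * h = h * (3 * C) * poissonint tau x y by ring.
rewrite /poissonint -RintegralB//.
apply: (le_trans (le_normr_Rintegral _ _)) => //; first exact: Rintegrable_sub.
rewrite -RintegralZl//.
apply: le_Rintegral => //.
- by apply: Rintegrable_abs; exact: Rintegrable_sub.
- exact: Rintegrable_scale.
move=> t _; have [SC QC [r rC ->]] := H tau x t a b h a1 b1 h0 he.
set K := poissonprod _ _ _ _; have K0 : 0 < K by exact: poissonprod_gt0.
move: SC QC; set S := \sum_i _; set Q := _ + _ => SC QC.
have -> : K * (1 + S * h + Q * h ^+ 2 + r * h ^+ 3) - K =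
  h * (S + Q * h + r * (h * h)) * K by ring.
rewrite normrM (gtr0_norm K0) ler_wpM2r ?(ltW K0)//.
rewrite normrM (ger0_norm h0) ler_wpM2l//.
have hh : `|h| <= 1 by rewrite ger0_norm// (le_trans he).
apply: le_trans (normD_le (normD_le SC (normM_le QC hh))
  (normM_le rC (normM_le hh hh))) _.
by rewrite !mulr1 (_ : 3 * C = C + C + C)//; ring.
Qed.

(** In the five-point difference of the product kernel the first order terms cancel
by symmetry and the second order terms of the factors by harmonicity of the
kernel; only [offdiag] is left at order two, and its integral vanishes. *)
Lemma poissonint_laplacian tau x y : 0 < y -> exists K e : R, 0 < e /\
  forall h, 0 <= h -> h <= e -> `|laplacian_diff (poissonint tau) x y h| <= K * h ^+ 3.
Proof.
move=> y0; have [C [e [C0 e0 e1 H]]] := poissonprod_expansion y0.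
have iK := Rintegrable_poissonprod tau x y0.
have [iO O0] := Rintegral_offdiag tau x y0.
exists (4 * C * poissonint tau x y), (Num.min e (y / 2)).
rewrite lt_min e0 divr_gt0//; split => // h h0; rewrite le_min => /andP[he hy].
pose D t := poissonprod tau (x + h) y t + poissonprod tau (x - h) y t +
  poissonprod tau x (y + h) t + poissonprod tau x (y - h) t - 4 * poissonprod tau x y t.
pose E t := D t - h ^+ 2 * (poissonprod tau x y t * offdiag tau x y t).
have yp : 0 < y + h by lra.
have ym : 0 < y - h by lra.
have i1 := Rintegrable_poissonprod tau (x + h) y0.
have i2 := Rintegrable_poissonprod tau (x - h) y0.
have i3 := Rintegrable_poissonprod tau x yp.
have i4 := Rintegrable_poissonprod tau x ym.
have iD2 := Rintegrable_add i1 i2.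
have iD3 := Rintegrable_add iD2 i3.
have iD4 := Rintegrable_add iD3 i4.
have i5 := Rintegrable_scale 4 iK.
have iD : Rintegrable D := Rintegrable_sub iD4 i5.
have i6 := Rintegrable_scale (h ^+ 2) iO.
have iE : Rintegrable E := Rintegrable_sub iD i6.
have -> : laplacian_diff (poissonint tau) x y h = \int[mu]_t E t.
  rewrite /E RintegralB// RintegralZl// O0 mulr0 subr0 /D /laplacian_diff.
  by rewrite RintegralB// !RintegralD// RintegralZl.
apply: (le_trans (le_normr_Rintegral _ _)) => //.
have -> : 4 * C * poissonint tau x y * h ^+ 3 =
  h ^+ 3 * (4 * C) * poissonint tau x y by ring.
rewrite -RintegralZl//.
apply: le_Rintegral => //.
- exact: Rintegrable_abs.
- exact: Rintegrable_scale.
move=> t _; rewrite /E /D.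
have [SX [QX [SY [QY [offE dir]]]]] : exists SX QX SY QY : R,
    offdiag tau x y t = SX ^+ 2 - QX + (SY ^+ 2 - QY) /\
    forall a b x' y', a * b = 0 -> `|a| <= 1 -> `|b| <= 1 ->
      x' = x + a * h -> y' = y + b * h -> exists2 r : R, `|r| <= C &
      poissonprod tau x' y' t = poissonprod tau x y t *
        (1 + (a * SX + b * SY) * h +
         (\sum_(i < n) poisson_expansion2 a b (centred tau x i t) y +
          ((a * SX + b * SY) ^+ 2 - (a ^+ 2 * QX + b ^+ 2 * QY)) / 2) * h ^+ 2 +
         r * h ^+ 3).
  exists (\sum_(i < n) dlogx_at tau x y i t), (\sum_(i < n) dlogx_at tau x y i t ^+ 2).
  exists (\sum_(i < n) dlogy_at tau x y i t), (\sum_(i < n) dlogy_at tau x y i t ^+ 2).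
  split=> // a b x' y' ab a1 b1 -> ->.
  have [_ _ [r rC ->]] := H tau x t a b h a1 b1 h0 he; exists r => //.
  rewrite big_split/= -!mulr_sumr.
  congr (_ * (_ + (_ + (_ - _) / 2) * _ + _)).
  rewrite !mulr_sumr -big_split/=; apply: eq_bigr => i _.
  by rewrite sqrrD !exprMn (mulrACA a _ b) ab mul0r mul0rn addr0.
have [r1 r1C ->] := dir 1 0 (x + h) y ltac:(ring) ltac:(by rewrite normr1)
    ltac:(by rewrite normr0) ltac:(ring) ltac:(ring).
have [r2 r2C ->] := dir (-1) 0 (x - h) y ltac:(ring) ltac:(by rewrite normrN1)
    ltac:(by rewrite normr0) ltac:(ring) ltac:(ring).
have [r3 r3C ->] := dir 0 1 x (y + h) ltac:(ring) ltac:(by rewrite normr0)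
    ltac:(by rewrite normr1) ltac:(ring) ltac:(ring).
have [r4 r4C ->] := dir 0 (-1) x (y - h) ltac:(ring) ltac:(by rewrite normr0)
    ltac:(by rewrite normrN1) ltac:(ring) ltac:(ring).
have P0 : \sum_(i < n) poisson_expansion2 1 0 (centred tau x i t) y +
    \sum_(i < n) poisson_expansion2 (-1) 0 (centred tau x i t) y +
    \sum_(i < n) poisson_expansion2 0 1 (centred tau x i t) y +
    \sum_(i < n) poisson_expansion2 0 (-1) (centred tau x i t) y = 0.
  by rewrite -!big_split/=; apply: big1 => i _; exact: poisson_expansion2_harmonic.
rewrite offE; move: P0.
set P1 := \sum_i _; set P2 := \sum_i _; set P3 := \sum_i _; set P4 := \sum_i _ => P0.
have K0 := poissonprod_gt0 tau x t y0.
move: (poissonprod tau x y t) K0 => K K0.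
have -> : P4 = P1 + P2 + P3 + P4 - (P1 + P2 + P3) by ring.
rewrite P0 sub0r.
rewrite (_ : _ - _ = h ^+ 3 * (r1 + r2 + r3 + r4) * K); last by field.
rewrite normrM (gtr0_norm K0) ler_wpM2r ?(ltW K0)//.
rewrite normrM ger0_norm ?exprn_ge0// ler_wpM2l ?exprn_ge0//.
apply: le_trans (normD_le (normD_le (normD_le r1C r2C) r3C) r4C) _.
by rewrite (_ : 4 * C = C + C + C + C)//; ring.
Qed.

Lemma poissonint_harmonic tau x y : 0 < y -> harmonic_at (poissonint tau) x y.
Proof.
by move=> y0; split; [exact: poissonint_lipschitz|exact: poissonint_laplacian].
Qed.

End PoissonIntegral.

(** * Growth along vertical rays *)

Section Growth.
Context {R : realType} {n : nat}.
Variable mu : {measure set borelRn R n -> \bar R}.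
Hypothesis growth : growth_condition mu.
Hypothesis nev : nevanlinna_condition mu.
Local Notation v := (poissonint mu).

(** Moving the centre of each kernel by at most a multiple of the height changes
the kernels by a bounded factor. *)
Lemma poissonint_translate_le k (tau tau' : 'rV[R]_n) (x x' y : R) : 0 < y ->
  (forall j, (tau 0 j + x - (tau' 0 j + x')) ^+ 2 <= k * y ^+ 2) ->
  v tau x y <= (2 * k + 2) ^+ n * v tau' x' y.
Proof.
move=> y0 H; apply: poissonint_le => // j s; apply: poisson_le => //.
rewrite mulrAC [leRHS]mulrC ler_wpM2l ?(ltW y0)//.
have := H j; set u := s - tau 0 j - x; set d := tau 0 j + x - _ => Hd.
have -> : s - tau' 0 j - x' = u + d by rewrite /u /d; ring.
have : (u + d) ^+ 2 <= 2 * u ^+ 2 + 2 * d ^+ 2.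
  by have := sqr_ge0 (u - d); lra.
have k0 : 0 <= k * u ^+ 2.
  rewrite mulr_ge0 ?sqr_ge0// -(pmulr_lge0 _ (exprn_gt0 2 y0)).
  exact: le_trans (sqr_ge0 d) Hd.
have : 0 <= u ^+ 2 by exact: sqr_ge0. have : 0 <= y ^+ 2 by exact: sqr_ge0.
lra.
Qed.

(** The barrier [g] is the Poisson kernel with pole at [0] corrected twice: the
kernel with pole at [- 3 i y] makes it nonpositive on the line of height [y] away
from [|x| <= 4 y], and the constant makes it nonpositive on the three far sides.
At [(0, Y)] it keeps the value [1 / (4 Y)], against at most [1 / y] near
[(0, y)]. *)
Lemma poissonint_climb tau (y Y : R) : 0 < y -> y <= Y ->
  v tau 0 y <= 4 * 34 ^+ n * (Y / y) * v tau 0 Y.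
Proof.
move=> y0 yY; have Y0 : 0 < Y by exact: lt_le_trans yY.
pose k : R := (34 ^+ n)^-1.
have k0 : 0 < k by rewrite invr_gt0 exprn_gt0.
pose V := v tau 0 y; rewrite -/V.
have V0 : 0 <= V by exact: poissonint_ge0.
pose g x e := poisson x e + (- 2^-1) * poisson x (e + 3 * y) + (- (4 * Y)^-1) * 1.
(* As [g <= y^-1], this makes [c * g] at most [k * V], a lower bound for [v] on the
part of the bottom side where [g] may be positive. *)
pose c := k * V * y.
have c0 : 0 <= c by rewrite !mulr_ge0// ltW.
have vg0 x e : 0 < e -> g x e <= 0 -> 0 <= v tau x e + (- c) * g x e.
  move=> e0 ge0; rewrite addr_ge0 ?poissonint_ge0// mulNr -mulrN mulr_ge0// oppr_ge0//.
have g_le x e : 0 < e -> g x e <= poisson x e - (4 * Y)^-1.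
  move=> e0; have e3 : 0 < e + 3 * y by rewrite addr_gt0// mulr_gt0.
  by rewrite /g mulr1; have := poisson_gt0 x e3; lra.
suff : 0 <= v tau 0 Y + (- c) * g 0 Y.
  have gY : (4 * Y)^-1 <= g 0 Y.
    rewrite /g mulr1 !poisson0 ?addr_gt0 ?mulr_gt0//.
    have : (Y + 3 * y)^-1 <= Y^-1.
      by rewrite lef_pV2 ?posrE ?addr_gt0 ?mulr_gt0// lerDl mulr_ge0// ltW.
    rewrite invfM; lra.
  move=> H; have : c * (4 * Y)^-1 <= v tau 0 Y.
    have : c * (4 * Y)^-1 <= c * g 0 Y by rewrite ler_wpM2l.
    lra.
  rewrite ler_pdivrMr ?mulr_gt0// => H1.
  have -> : V = 34 ^+ n * y^-1 * c.
    by rewrite /c /k; field; rewrite !gt_eqF// exprn_gt0.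
  have -> : 4 * 34 ^+ n * (Y / y) * v tau 0 Y =
    34 ^+ n * y^-1 * (v tau 0 Y * (4 * Y)) by ring.
  by rewrite ler_wpM2l// mulr_ge0 ?exprn_ge0// invr_ge0 ltW.
have := @minimum_principle R (fun x e => v tau x e + (- c) * g x e)
  (- (4 * Y)) (4 * Y) y (5 * Y); apply; last 2 first.
- by apply/andP; lra.
- by apply/andP; lra.
- move=> x e _ /andP[ye _]; have e0 : 0 < e by exact: lt_le_trans ye.
  apply: harmonic_at_lin; first exact: poissonint_harmonic.
  apply: harmonic_at_lin; last exact: harmonic_at_cst.
  apply: harmonic_at_lin; first exact: harmonic_at_poisson.
  by apply/harmonic_at_shift/harmonic_at_poisson; rewrite addr_gt0// mulr_gt0.
move=> x e /andP[xl xr] /andP[ye eY].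
have e0 : 0 < e by exact: lt_le_trans ye.
have side : x ^+ 2 = (4 * Y) ^+ 2 -> 0 <= v tau x e + - c * g x e.
  move=> xY; apply: vg0 => //; apply: le_trans (g_le _ _ e0) _.
  rewrite subr_le0 /poisson ler_pdivrMr ?sqr_sum_gt0// mulrC ler_pdivlMr ?mulr_gt0//.
  by rewrite xY; have := sqr_ge0 (e - 2 * Y); have := sqr_ge0 Y; lra.
case/or4P => /eqP E.
- by apply: side; rewrite E sqrrN.
- by apply: side; rewrite E.
- have [x4|x4] := leP ((4 * y) ^+ 2) (x ^+ 2).
    apply: vg0 => //; rewrite /g mulr1 E.
    have Y4 : 0 <= (4 * Y)^-1 by rewrite invr_ge0 mulr_ge0 ?ltW.
    suff : poisson x y <= 2^-1 * poisson x (y + 3 * y) by lra.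
    apply: poisson_le => //; first by rewrite addr_gt0 ?mulr_gt0.
    rewrite (_ : 2^-1 * (y + 3 * y) = y * 2); last by field.
    by rewrite -mulrA ler_wpM2l ?(ltW y0)//; have := sqr_ge0 y; lra.
  have Vx : V <= 34 ^+ n * v tau x y.
    rewrite (_ : 34 = 2 * 16 + 2); last by ring.
    apply: poissonint_translate_le => // j.
    by rewrite (_ : _ - _ = - x) ?sqrrN; [lra|ring].
  rewrite E mulNr subr_ge0.
  have gy : g x y <= y^-1.
    apply: le_trans (g_le _ _ y0) _.
    have Y4 : 0 <= (4 * Y)^-1 by rewrite invr_ge0 mulr_ge0 ?ltW.
    suff : poisson x y <= y^-1 by lra.
    rewrite ler_pdivrMr ?sqr_sum_gt0// mulrC ler_pdivlMr//.
    by have := sqr_ge0 x; lra.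
  apply: le_trans (_ : c * y^-1 <= _); first by rewrite ler_wpM2l.
  rewrite /c mulfK ?gt_eqF// /k mulrC ler_pdivrMr ?exprn_gt0//.
  by rewrite mulrC.
- apply: vg0 => //; apply: le_trans (g_le _ _ e0) _.
  rewrite subr_le0 /poisson ler_pdivrMr ?sqr_sum_gt0// mulrC ler_pdivlMr ?mulr_gt0//.
  by rewrite E; have := sqr_ge0 x; have := sqr_ge0 Y; lra.
Qed.

(** The barrier is [Im (w - w ^+ 3 / Y ^+ 2)], nonpositive on the vertical sides
[|x| = Y], at most [2 Y] on the top side and vanishing on the real axis.  As [v]
is not controlled there, the bottom side is put at height [1 / 4] and the barrier
lowered by [1 / 2], which still leaves at least [1 / 2] at [(0, 1)]. *)
Lemma poissonint_descend tau (Y : R) : 1 <= Y ->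
  v tau 0 Y <= 4 * 4 ^+ n * Y * v tau 0 1.
Proof.
move=> Y1; have Y0 : 0 < Y by exact: lt_le_trans Y1.
pose k : R := (4 ^+ n)^-1.
have k0 : 0 < k by rewrite invr_gt0 exprn_gt0.
pose V := v tau 0 Y; rewrite -/V.
have V0 : 0 <= V by exact: poissonint_ge0.
pose g x e := e + (Y ^+ 2)^-1 * cubic x e + (- 2^-1) * 1.
(* As [g <= 2 * Y] on the top side, [c * g] is there at most [k * V <= v]. *)
pose c := k * V / (2 * Y).
have c0 : 0 <= c by rewrite !mulr_ge0 ?invr_ge0 ?mulr_ge0// ltW.
have Y20 : 0 < Y ^+ 2 by exact: exprn_gt0.
have vg0 x e : 0 < e -> g x e <= 0 -> 0 <= v tau x e + (- c) * g x e.
  move=> e0 ge0; rewrite addr_ge0 ?poissonint_ge0// mulNr -mulrN mulr_ge0// oppr_ge0//.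
suff : 0 <= v tau 0 1 + (- c) * g 0 1.
  have g1 : 2^-1 <= g 0 1.
    rewrite /g /cubic expr1n expr0n mulr0 mul0r subr0 !mulr1.
    have : 0 <= (Y ^+ 2)^-1 by rewrite invr_ge0 ltW.
    lra.
  move=> H; have : c * 2^-1 <= v tau 0 1.
    have : c * 2^-1 <= c * g 0 1 by rewrite ler_wpM2l.
    lra.
  move=> H1.
  have -> : V = 4 * 4 ^+ n * Y * (c * 2^-1).
    by rewrite /c /k; field; rewrite !gt_eqF// exprn_gt0.
  by rewrite ler_wpM2l// !mulr_ge0 ?exprn_ge0// ltW.
have := @minimum_principle R (fun x e => v tau x e + (- c) * g x e)
  (- Y) Y 4^-1 Y; apply; last 2 first.
- by apply/andP; lra.
- by apply/andP; lra.
- move=> x e _ /andP[ye _]; have e0 : 0 < e by exact: lt_le_trans ye.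
  apply: harmonic_at_lin; first exact: poissonint_harmonic.
  apply: harmonic_at_lin; last exact: harmonic_at_cst.
  by apply: harmonic_at_lin; [exact: harmonic_at_snd|exact: harmonic_at_cubic].
move=> x e /andP[xl xr] /andP[ye eY].
have e0 : 0 < e by exact: lt_le_trans ye.
have gE : g x e = (Y ^+ 2)^-1 * (e * (Y ^+ 2 - 3 * x ^+ 2 + e ^+ 2)) - 2^-1.
  by rewrite /g /cubic; field; rewrite gt_eqF.
have eY2 : e ^+ 2 <= Y ^+ 2 by rewrite lerXn2r ?nnegrE ?(ltW e0) ?(ltW Y0).
have side : x ^+ 2 = Y ^+ 2 -> 0 <= v tau x e + - c * g x e.
  move=> xY; apply: vg0 => //; rewrite gE xY.
  have : (Y ^+ 2)^-1 * (e * (Y ^+ 2 - 3 * Y ^+ 2 + e ^+ 2)) <= 0.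
    by rewrite pmulr_rle0 ?invr_gt0// pmulr_rle0//; lra.
  lra.
case/or4P => /eqP E.
- by apply: side; rewrite E sqrrN.
- by apply: side; rewrite E.
- apply: vg0 => //; rewrite gE subr_le0 mulrC ler_pdivrMr//.
  have x2 := sqr_ge0 x; rewrite E in eY2 *.
  have : 1 <= Y ^+ 2 by rewrite expr_ge1// ltW.
  lra.
have x2Y : x ^+ 2 <= 1 * Y ^+ 2.
  have : 0 <= (Y - x) * (Y + x) by apply: mulr_ge0; lra.
  lra.
have Vx : V <= 4 ^+ n * v tau x Y.
  rewrite (_ : 4 = 2 * 1 + 2); last by ring.
  apply: poissonint_translate_le => // j.
  by rewrite (_ : _ - _ = - x) ?sqrrN; [|ring].
rewrite E mulNr subr_ge0.
have gy : g x Y <= 2 * Y.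
  rewrite -E gE E.
  have : (Y ^+ 2)^-1 * (Y * (Y ^+ 2 - 3 * x ^+ 2 + Y ^+ 2)) <= 2 * Y.
    rewrite mulrC ler_pdivrMr// mulrAC [leRHS]mulrC ler_wpM2l ?(ltW Y0)//.
    by have := sqr_ge0 x; lra.
  lra.
apply: le_trans (_ : c * (2 * Y) <= _); first by rewrite ler_wpM2l.
rewrite /c mulfVK ?gt_eqF ?mulr_gt0// /k mulrC ler_pdivrMr ?exprn_gt0//.
by rewrite mulrC.
Qed.

End Growth.

(** * The estimate on cubes *)

Theorem proposition5p1 (R : realType) (n : nat) (n_gt0 : (0 < n)%N)
    (mu : {measure set borelRn R n -> \bar R}) (mu_nev : nevanlinna_measure mu) :
  exists M : R, 0 <= M /\
    forall (tau : 'rV[R]_n) (y : R), 0 < y ->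
      (mu (open_cube tau y) <=
        (M / (2 * pi) ^+ n * (y ^+ n.-1 / Num.sqrt n%:R) *
         (1 + norm2 tau ^+ 2 + n%:R * y ^+ 2))%:E)%E.
Proof.
case: mu_nev => growth nev.
pose v := poissonint mu.
have sn0 : 0 < Num.sqrt (n%:R : R) by rewrite sqrtr_gt0 ltr0n.
have pin0 : 0 < (2 * pi : R) ^+ n by rewrite exprn_gt0// mulr_gt0// pi_gt0.
pose N : R := 2 ^+ n * (4 * 34 ^+ n) * 4 ^+ n * (4 * 4 ^+ n) * v 0 0 1.
have v1 : 0 <= v 0 0 1 by exact: poissonint_ge0.
have N0 : 0 <= N by rewrite !mulr_ge0 ?exprn_ge0.
exists (N * (2 * pi) ^+ n * Num.sqrt n%:R); split.
  by rewrite !mulr_ge0 ?(ltW pin0) ?(ltW sn0).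
move=> tau y y0.
apply: le_trans (measure_open_cube_le growth tau y0) _; rewrite lee_fin.
set S := 1 + _ + _.
have norm2E : norm2 tau ^+ 2 = \sum_(j < n) tau 0 j ^+ 2.
  by rewrite sqr_sqrtr// sumr_ge0// => j _; rewrite sqr_ge0.
have ny2 : y ^+ 2 <= n%:R * y ^+ 2 by rewrite ler_peMl ?sqr_ge0// ler1n.
have tau2 : 0 <= norm2 tau ^+ 2 by exact: sqr_ge0.
have S1 : 1 <= S by have := sqr_ge0 y; rewrite /S; lra.
have Sy : y ^+ 2 <= S by rewrite /S; lra.
pose Y := Num.sqrt S.
have Y2 : Y ^+ 2 = S by rewrite sqr_sqrtr// (le_trans ler01).
have Y1 : 1 <= Y by rewrite -sqrtr1 ler_wsqrtr.
have Y0 : 0 < Y by exact: lt_le_trans Y1.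
have yY : y <= Y by rewrite -[y](@gtr0_norm R)// -sqrtr_sqr ler_wsqrtr.
have H1 := poissonint_climb growth nev tau y0 yY.
have H2 : v tau 0 Y <= 4 ^+ n * v 0 0 Y.
  rewrite (_ : 4 = 2 * 1 + 2); last by ring.
  apply: poissonint_translate_le => // j.
  rewrite mxE !addr0 subr0 mul1r Y2 /S norm2E (bigD1 j)//=.
  have : 0 <= \sum_(i < n | i != j) tau 0 i ^+ 2.
    by apply: sumr_ge0 => i _; exact: sqr_ge0.
  by have := sqr_ge0 y; lra.
have H3 := poissonint_descend growth nev 0 Y1.
have -> : N * (2 * pi) ^+ n * Num.sqrt n%:R / (2 * pi) ^+ n *
    (y ^+ n.-1 / Num.sqrt n%:R) * S =
  (2 * y) ^+ n * (4 * 34 ^+ n * (Y / y) * (4 ^+ n * (4 * 4 ^+ n * Y * v 0 0 1))).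
  have yn : y ^+ n = y * y ^+ n.-1 by rewrite -exprS prednK.
  rewrite -Y2 (exprMn n 2 y) yn /N.
  move: ((2 * pi) ^+ n) pin0 => P P0.
  by field; rewrite !gt_eqF.
have yn : 0 <= (2 * y) ^+ n by rewrite exprn_ge0// mulr_ge0// ltW.
rewrite ler_wpM2l//; apply: le_trans H1 _.
rewrite ler_wpM2l ?mulr_ge0 ?invr_ge0 ?exprn_ge0 ?(ltW y0) ?(ltW Y0)//.
by apply: le_trans H2 _; rewrite ler_wpM2l// exprn_ge0.
Qed.
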